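(* There exists a unique algebra homomorphism $\psi: U_q({\rm iso}_2)\to \hat U_q({\rm m}_2)$ such that $$\psi(I)=\frac{\mathrm{i}}{q-q^{-1}}\,(q^H-q^{-H}),$$ $$\psi(T_2)=(E-F)\,(q^H+q^{-H})^{-1},$$ $$\psi(T_1)=\left(\mathrm{i}\,q^{H-1/2}E+\mathrm{i}\,q^{-H-1/2}F\right)(q^H+q^{-H})^{-1},$$ where $q^{\pm H+a}:=q^{\pm H}q^a$ for scalars $q^a$.
   Context: Let $q$ be a nonzero complex number with $q^2\neq 1$, with a fixed square root $q^{1/2}$ (and $q^{-1/2}=1/q^{1/2}$); $\mathrm{i}=\sqrt{-1}$. $U_q({\rm iso}_2)$ is the complex associative algebra with unit generated by $I,T_1,T_2$ subject to the defining relations $$q^{1/2}IT_2-q^{-1/2}T_2I=T_1,\qquad q^{1/2}T_1I-q^{-1/2}IT_1=T_2,\qquad q^{1/2}T_2T_1-q^{-1/2}T_1T_2=0.$$ $\hat U_q({\rm m}_2)$ is the complex associative algebra with unit generated by the symbols $q^H,\ q^{-H},\ E,\ F$ and $(q^kq^H+q^{-k}q^{-H})^{-1}$, $k\in\mathbf Z$, subject to the defining relations $$q^Hq^{-H}=q^{-H}q^H=1,\quad q^HEq^{-H}=qE,\quad q^HFq^{-H}=q^{-1}F,\quad EF-FE=0,$$ and, for all $k\in\mathbf Z$, $$(q^kq^H+q^{-k}q^{-H})^{-1}(q^kq^H+q^{-k}q^{-H})=(q^kq^H+q^{-k}q^{-H})(q^kq^H+q^{-k}q^{-H})^{-1}=1,$$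 $$q^{\pm H}(q^kq^H+q^{-k}q^{-H})^{-1}=(q^kq^H+q^{-k}q^{-H})^{-1}q^{\pm H},$$ $$(q^kq^H+q^{-k}q^{-H})^{-1}E=E(q^{k+1}q^H+q^{-k-1}q^{-H})^{-1},$$ $$(q^kq^H+q^{-k}q^{-H})^{-1}F=F(q^{k-1}q^H+q^{-k+1}q^{-H})^{-1}.$$ The element $(q^H+q^{-H})^{-1}$ is the generator with $k=0$. *)

(* Defs.v *)
From HB Require Import structures.
From mathcomp Require Import all_boot all_order all_algebra.
From mathcomp Require Import boolp reals complex.
From mathcomp Require Import finmap monalg zify.

Set Implicit Arguments.
Unset Strict Implicit.
Unset Printing Implicit Defensive.

Import Order.TTheory GRing.Theory Num.Theory.

Local Open Scope ring_scope.
Local Open Scope quotient_scope.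

Lemma malg_scalerAr (K : comNzRingType) (M : monomType) (c : K)
  (x y : {malg K[M]}) : c *: (x * y) = x * (c *: y).
Proof.
apply/malgP=> m; rewrite mcoeffZ mcoeffMl mulr_sumr.
rewrite (mcoeffMlw m (fsubset_refl (msupp x)) (@msuppZ_le _ _ c y)).
apply: eq_bigr => i _; rewrite mulr_sumr; apply: eq_bigr => j _.
by rewrite mcoeffZ mulrnAr mulrCA.
Qed.

(* The monoid algebra of the free monoid on X; multiplication and scaling are
   locked because unification would otherwise try to compute them. *)
Definition free_alg (K : comNzRingType) (X : choiceType) : Type :=
  {malg K[{fmonom X}]}.

HB.lock Definition free_mul (K : comNzRingType) (X : choiceType)
  (x y : {malg K[{fmonom X}]}) : free_alg K X := x * y.

HB.lock Definition free_scale (K : comNzRingType) (X : choiceType)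
  (c : K) (x : {malg K[{fmonom X}]}) : free_alg K X := c *: x.

HB.lock Definition free_one (K : comNzRingType) (X : choiceType) :
  free_alg K X := 1 : {malg K[{fmonom X}]}.

HB.lock Definition free_gen (K : comNzRingType) (X : choiceType) (x : X) :
  free_alg K X := << fmu x >>.

Section FreeAlgebra.
Variables (K : comNzRingType) (X : choiceType).
Local Notation malg := {malg K[{fmonom X}]}.

HB.instance Definition _ := GRing.Zmodule.on (free_alg K X).

Lemma free_mulA : associative (@free_mul K X).
Proof. by move=> x y z; rewrite free_mul.unlock; apply: (@mulrA malg). Qed.

Lemma free_mul1 : left_id (free_one K X) (@free_mul K X).
Proof. by rewrite free_mul.unlock free_one.unlock; apply: (@mul1r malg). Qed.

Lemma free_mulr1 : right_id (free_one K X) (@free_mul K X).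
Proof. by rewrite free_mul.unlock free_one.unlock; apply: (@mulr1 malg). Qed.

Lemma free_mulDl : left_distributive (@free_mul K X) +%R.
Proof. by rewrite free_mul.unlock; apply: (@mulrDl malg). Qed.

Lemma free_mulDr : right_distributive (@free_mul K X) +%R.
Proof. by rewrite free_mul.unlock; apply: (@mulrDr malg). Qed.

Lemma free_one_neq0 : free_one K X != 0.
Proof. by rewrite free_one.unlock; apply: (@oner_neq0 malg). Qed.

HB.instance Definition _ := GRing.Zmodule_isNzRing.Build (free_alg K X)
  free_mulA free_mul1 free_mulr1 free_mulDl free_mulDr free_one_neq0.

Lemma free_scaleA a b (x : free_alg K X) :
  free_scale a (free_scale b x) = free_scale (a * b) x.
Proof. by rewrite free_scale.unlock; apply: (@scalerA K malg). Qed.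

Lemma free_scale1 : left_id 1 (@free_scale K X).
Proof. by rewrite free_scale.unlock; apply: (@scale1r K malg). Qed.

Lemma free_scaleDr : right_distributive (@free_scale K X) +%R.
Proof. by rewrite free_scale.unlock; apply: (@scalerDr K malg). Qed.

Lemma free_scaleDl x : {morph (@free_scale K X)^~ x : a b / a + b}.
Proof. by rewrite free_scale.unlock; apply: (@scalerDl K malg). Qed.

HB.instance Definition _ := GRing.Zmodule_isLmodule.Build K (free_alg K X)
  free_scaleA free_scale1 free_scaleDr free_scaleDl.

Lemma free_scalerAl (c : K) (x y : free_alg K X) : c *: (x * y) = (c *: x) * y.
Proof.
rewrite /GRing.scale /GRing.mul /= free_scale.unlock free_mul.unlock.
exact: (@scalerAl K malg).
Qed.

Lemma free_scalerAr (c : K) (x y : free_alg K X) : c *: (x * y) = x * (c *: y).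
Proof.
rewrite /GRing.scale /GRing.mul /= free_scale.unlock free_mul.unlock.
exact: malg_scalerAr.
Qed.

HB.instance Definition _ :=
  GRing.Lmodule_isLalgebra.Build K (free_alg K X) free_scalerAl.
HB.instance Definition _ :=
  GRing.Lalgebra_isAlgebra.Build K (free_alg K X) free_scalerAr.

End FreeAlgebra.

Section QuotientByRelations.
Variables (K : comNzRingType) (A : algType K) (rel : A -> A -> Prop).

(* The two-sided ideal generated by the differences x - y with rel x y. *)
Inductive rel_ideal : A -> Prop :=
| rel_ideal_rel x y of rel x y : rel_ideal (x - y)
| rel_ideal0 : rel_ideal 0
| rel_idealD x y of rel_ideal x & rel_ideal y : rel_ideal (x + y)
| rel_idealMl a x of rel_ideal x : rel_ideal (a * x)
| rel_idealMr x a of rel_ideal x : rel_ideal (x * a).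

Definition rel_ideal_pred : {pred A} := fun x => `[< rel_ideal x >].

Lemma rel_idealP x : reflect (rel_ideal x) (x \in rel_ideal_pred).
Proof. exact: asboolP. Qed.

Lemma rel_ideal_zmod_closed : zmod_closed rel_ideal_pred.
Proof.
split=> [|x y /rel_idealP Ix /rel_idealP Iy]; apply/rel_idealP.
  exact: rel_ideal0.
by apply: rel_idealD => //; rewrite -mulN1r; apply: rel_idealMl.
Qed.

HB.instance Definition _ :=
  GRing.isZmodClosed.Build A rel_ideal_pred rel_ideal_zmod_closed.

Definition alg_quot : Type := Quotient.quot rel_ideal_pred.

HB.instance Definition _ := GRing.Zmodule.on alg_quot.
HB.instance Definition _ := EqQuotient.on alg_quot.

Definition alg_pi (x : A) : alg_quot := \pi_alg_quot x.

Lemma alg_piP x y : reflect (rel_ideal (x - y)) (alg_pi x == alg_pi y).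
Proof. by rewrite /alg_pi -Quotient.idealrBE; apply: rel_idealP. Qed.

Lemma alg_pi_repr (u : alg_quot) : alg_pi (repr u) = u.
Proof. exact: reprK. Qed.

Lemma alg_piD : {morph alg_pi : x y / x + y}.
Proof. by move=> x y; rewrite /alg_pi [LHS]Quotient.pi_add. Qed.

Lemma alg_pi0 : alg_pi 0 = 0.
Proof. by apply: (addrI (alg_pi 0)); rewrite -alg_piD !addr0. Qed.

Definition alg_quot_one : alg_quot := alg_pi 1.
Definition alg_quot_mul := lift_op2 alg_quot *%R.
Definition alg_quot_scale (c : K) := lift_op1 alg_quot ( *:%R c).

Lemma alg_repr_pi x : rel_ideal (repr (alg_pi x) - x).
Proof. by apply/alg_piP; rewrite alg_pi_repr. Qed.

Lemma alg_pi_mul x y : alg_quot_mul (alg_pi x) (alg_pi y) = alg_pi (x * y).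
Proof.
unlock alg_quot_mul; apply/eqP/alg_piP; set x' := repr _; set y' := repr _.
have -> : x' * y' - x * y = (x' - x) * y' + x * (y' - y).
  by rewrite mulrBl mulrBr addrA subrK.
by apply: rel_idealD; [apply: rel_idealMr | apply: rel_idealMl];
  apply: alg_repr_pi.
Qed.

Lemma alg_pi_scale c x : alg_quot_scale c (alg_pi x) = alg_pi (c *: x).
Proof.
rewrite /alg_quot_scale; unlock; apply/eqP/alg_piP; rewrite -scalerBr -mulr_algl.
by apply: rel_idealMl; apply: alg_repr_pi.
Qed.

Lemma alg_quot_ind (P : alg_quot -> Prop) :
  (forall x, P (alg_pi x)) -> forall u, P u.
Proof. by move=> Ppi u; rewrite -[u]alg_pi_repr. Qed.

Lemma alg_quot_mulA : associative alg_quot_mul.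
Proof.
elim/alg_quot_ind=> x; elim/alg_quot_ind=> y; elim/alg_quot_ind=> z.
by rewrite !alg_pi_mul mulrA.
Qed.

Lemma alg_quot_mul1 : left_id alg_quot_one alg_quot_mul.
Proof. by elim/alg_quot_ind=> x; rewrite alg_pi_mul mul1r. Qed.

Lemma alg_quot_mulr1 : right_id alg_quot_one alg_quot_mul.
Proof. by elim/alg_quot_ind=> x; rewrite alg_pi_mul mulr1. Qed.

Lemma alg_quot_mulDl : left_distributive alg_quot_mul +%R.
Proof.
elim/alg_quot_ind=> x; elim/alg_quot_ind=> y; elim/alg_quot_ind=> z.
by rewrite -alg_piD !alg_pi_mul -alg_piD mulrDl.
Qed.

Lemma alg_quot_mulDr : right_distributive alg_quot_mul +%R.
Proof.
elim/alg_quot_ind=> x; elim/alg_quot_ind=> y; elim/alg_quot_ind=> z.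
by rewrite -alg_piD !alg_pi_mul -alg_piD mulrDr.
Qed.

(* Only a pzRingType: the quotient may collapse to 0, depending on rel. *)
HB.instance Definition _ := GRing.Zmodule_isPzRing.Build alg_quot
  alg_quot_mulA alg_quot_mul1 alg_quot_mulr1 alg_quot_mulDl alg_quot_mulDr.

Lemma alg_quot_scaleA a b u :
  alg_quot_scale a (alg_quot_scale b u) = alg_quot_scale (a * b) u.
Proof. by elim/alg_quot_ind: u => x; rewrite !alg_pi_scale scalerA. Qed.

Lemma alg_quot_scale1 : left_id 1 alg_quot_scale.
Proof. by elim/alg_quot_ind=> x; rewrite alg_pi_scale scale1r. Qed.

Lemma alg_quot_scaleDr : right_distributive alg_quot_scale +%R.
Proof.
move=> c; elim/alg_quot_ind=> x; elim/alg_quot_ind=> y.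
by rewrite -alg_piD !alg_pi_scale -alg_piD scalerDr.
Qed.

Lemma alg_quot_scaleDl u : {morph alg_quot_scale^~ u : a b / a + b}.
Proof.
by elim/alg_quot_ind: u => x a b; rewrite !alg_pi_scale -alg_piD scalerDl.
Qed.

HB.instance Definition _ := GRing.Zmodule_isLmodule.Build K alg_quot
  alg_quot_scaleA alg_quot_scale1 alg_quot_scaleDr alg_quot_scaleDl.

Lemma alg_quot_scalerAl (c : K) (u v : alg_quot) : c *: (u * v) = (c *: u) * v.
Proof.
elim/alg_quot_ind: u => x; elim/alg_quot_ind: v => y.
change (alg_quot_scale c (alg_quot_mul (alg_pi x) (alg_pi y)) =
        alg_quot_mul (alg_quot_scale c (alg_pi x)) (alg_pi y)).
by rewrite alg_pi_mul !alg_pi_scale alg_pi_mul scalerAl.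
Qed.

Lemma alg_quot_scalerAr (c : K) (u v : alg_quot) : c *: (u * v) = u * (c *: v).
Proof.
elim/alg_quot_ind: u => x; elim/alg_quot_ind: v => y.
change (alg_quot_scale c (alg_quot_mul (alg_pi x) (alg_pi y)) =
        alg_quot_mul (alg_pi x) (alg_quot_scale c (alg_pi y))).
by rewrite alg_pi_mul !alg_pi_scale alg_pi_mul scalerAr.
Qed.

End QuotientByRelations.

Section Character.
Variables (K : comNzRingType) (X : choiceType) (chi : X -> K).

Definition mon_char (m : {fmonom X}) : K := \prod_(x <- m) chi x.

Lemma mon_char_mmorphism : mmorphism mon_char.
Proof.
split=> [m n|]; rewrite /mon_char; last by rewrite fm1 big_nil.
by rewrite fmM big_cat.
Qed.

HB.instance Definition _ := isMultiplicative.Build {fmonom X} K mon_char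
  mon_char_mmorphism.

Definition free_char (x : free_alg K X) : K := mmap idfun mon_char x.

Lemma free_char_gen x : free_char (free_gen K x) = chi x.
Proof. by rewrite /free_char free_gen.unlock mmapU /mon_char mul1r /= fmuE big_seq1. Qed.

Lemma free_charZ c x : free_char (c *: x) = c * free_char x.
Proof. by rewrite /GRing.scale /= free_scale.unlock; apply: mmapZ. Qed.

Lemma free_charB x y : free_char (x - y) = free_char x - free_char y.
Proof. exact: (raddfB (mmap idfun mon_char)). Qed.

Lemma free_char0 : free_char 0 = 0.
Proof. exact: (raddf0 (mmap idfun mon_char)). Qed.

Lemma free_charD x y : free_char (x + y) = free_char x + free_char y.
Proof. exact: (raddfD (mmap idfun mon_char)). Qed.

Lemma free_char1 : free_char 1 = 1.
Proof. by rewrite /GRing.one /= free_one.unlock; apply: mmap1. Qed.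

Lemma free_charM x y : free_char (x * y) = free_char x * free_char y.
Proof.
rewrite [x * y]/GRing.mul /= free_mul.unlock.
exact: (rmorphM (mmap idfun mon_char)).
Qed.

Definition free_charE := (free_charB, free_charD, free_charM, free_charZ,
  free_char0, free_char1, free_char_gen).

Lemma alg_quot_neq0 (rel : free_alg K X -> free_alg K X -> Prop) :
  (forall x y, rel x y -> free_char x = free_char y) ->
  1 != 0 :> alg_quot rel.
Proof.
move=> relE; apply/negP => one0.
have I1 : rel_ideal rel 1.
  by rewrite -[1]subr0; apply/alg_piP; rewrite alg_pi0.
suff: free_char 1 = 0 by move/eqP; rewrite free_char1 oner_eq0.
elim: I1 => [x y /relE xy||x y _ x0 _ y0|a x _ x0|x a _ x0].
- by rewrite free_charB xy subrr.
- by rewrite free_char0.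
- by rewrite free_charD x0 y0 addr0.
- by rewrite free_charM x0 mulr0.
- by rewrite free_charM x0 mul0r.
Qed.

End Character.

Inductive iso2_gen := Iso2_I | Iso2_T1 | Iso2_T2.

HB.instance Definition _ := gen_eqMixin iso2_gen.
HB.instance Definition _ := gen_choiceMixin iso2_gen.

(* M2_K and M2_Kinv stand for q^H and q^(-H), and M2_D k for the inverse of
   q^k q^H + q^(-k) q^(-H). *)
Inductive m2_gen := M2_K | M2_Kinv | M2_E | M2_F | M2_D of int.

HB.instance Definition _ := gen_eqMixin m2_gen.
HB.instance Definition _ := gen_choiceMixin m2_gen.

Section Iso2.
Variables (C : numClosedFieldType) (qh : C).

Local Notation I := (free_gen C Iso2_I).
Local Notation T1 := (free_gen C Iso2_T1).
Local Notation T2 := (free_gen C Iso2_T2).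

(* qh is the chosen square root of q. *)
Inductive iso2_rel : free_alg C iso2_gen -> free_alg C iso2_gen -> Prop :=
| iso2_IT2 : iso2_rel (qh *: (I * T2) - qh^-1 *: (T2 * I)) T1
| iso2_T1I : iso2_rel (qh *: (T1 * I) - qh^-1 *: (I * T1)) T2
| iso2_T2T1 : iso2_rel (qh *: (T2 * T1) - qh^-1 *: (T1 * T2)) 0.

Definition Uq_iso2 : Type := alg_quot iso2_rel.

HB.instance Definition _ := GRing.PzRing.on Uq_iso2.
HB.instance Definition _ := GRing.Lmodule.on Uq_iso2.

Lemma Uq_iso2_neq0 : 1 != 0 :> Uq_iso2.
Proof.
apply: (@alg_quot_neq0 _ _ (fun=> 0)) => x y [];
  by rewrite !free_charE !(mulr0, subr0).
Qed.

HB.instance Definition _ :=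
  GRing.PzSemiRing_isNonZero.Build Uq_iso2 Uq_iso2_neq0.
HB.instance Definition _ :=
  GRing.Lmodule_isLalgebra.Build C Uq_iso2 (@alg_quot_scalerAl _ _ iso2_rel).
HB.instance Definition _ :=
  GRing.Lalgebra_isAlgebra.Build C Uq_iso2 (@alg_quot_scalerAr _ _ iso2_rel).

Definition iso2 (x : iso2_gen) : Uq_iso2 := alg_pi iso2_rel (free_gen C x).

End Iso2.

Section M2.
Variables (C : numClosedFieldType) (q : C).

Local Notation K := (free_gen C M2_K).
Local Notation Kinv := (free_gen C M2_Kinv).
Local Notation E := (free_gen C M2_E).
Local Notation F := (free_gen C M2_F).
Local Notation D k := (free_gen C (M2_D k)).
Local Notation P k := (q ^ k *: K + q ^ (- k) *: Kinv).

Inductive m2_rel : free_alg C m2_gen -> free_alg C m2_gen -> Prop :=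
| m2_KKinv : m2_rel (K * Kinv) 1
| m2_KinvK : m2_rel (Kinv * K) 1
| m2_KE : m2_rel (K * E * Kinv) (q *: E)
| m2_KF : m2_rel (K * F * Kinv) (q^-1 *: F)
| m2_EF : m2_rel (E * F - F * E) 0
| m2_DP (k : int) : m2_rel (D k * P k) 1
| m2_PD (k : int) : m2_rel (P k * D k) 1
| m2_KD (k : int) : m2_rel (K * D k) (D k * K)
| m2_KinvD (k : int) : m2_rel (Kinv * D k) (D k * Kinv)
| m2_DE (k : int) : m2_rel (D k * E) (E * D (k + 1))
| m2_DF (k : int) : m2_rel (D k * F) (F * D (k - 1)).

(* An algType is non-trivial, and at q = 0 the relations force 1 = 0: hence the
   argument. *)
Definition Uq_m2 (q_neq0 : q != 0) : Type := alg_quot m2_rel.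

(* Used to make q^H act by the scalar t, showing that the relations are proper. *)
Lemma exists_generic_weight : q != 0 ->
  exists2 t : C, t != 0 & forall k : int, q ^ k * t + q ^ (- k) * t^-1 != 0.
Proof.
move=> q_neq0; have a_gt0 : 0 < `|q| by rewrite normr_gt0.
have normX (k : int) : `|q ^ k| = `|q| ^ k.
  by case: k => n; rewrite ?NegzE -?exprz_inv -?exprnP ?normrX ?normfV.
suff [t t_gt0 tP] : exists2 t : C, 0 < t & forall k : int, `|q| ^ k * t != 1.
  exists t => [|k]; first by rewrite gt_eqF.
  apply: contra (tP k); rewrite addr_eq0 => /eqP /(congr1 Num.norm).
  rewrite normrN -invr_expz -invfM normfV normrM normX (gtr0_norm t_gt0).
  have := mulr_gt0 (exprz_gt0 k a_gt0) t_gt0; set x := _ * t => x_gt0 xV.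
  rewrite -(@pexpr_eq1 _ x 2) ?ltW // expr2 {1}xV mulVf //.
  by rewrite gt_eqF.
have [a1|a_neq1] := eqVneq `|q| 1.
  exists 2 => [|k]; first exact: ltr0n.
  by rewrite a1 exp1rz mul1r pnatr_eq1.
exists (sqrtC `|q|) => [|k]; first by rewrite sqrtC_gt0.
apply: contraNneq a_neq1 => /(congr1 (fun x => x ^+ 2)).
rewrite exprMn sqrtCK expr1n => a2k.
have {}a2k : `|q| ^ (k * 2 + 1) = 1.
  by rewrite expfzDr ?gt_eqF // expr1z -exprz_exp.
have : `|q| ^ (k * 2 + 1) == 1 by rewrite a2k.
by rewrite pexprz_eq1 ?normr_ge0 // => /orP[/eqP|/eqP //]; lia.
Qed.

Lemma Uq_m2_neq0 (q_neq0 : q != 0) : 1 != 0 :> Uq_m2 q_neq0.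
Proof.
have [t t_neq0 tP] := exists_generic_weight q_neq0.
pose chi x := match x with
  | M2_K => t | M2_Kinv => t^-1 | M2_E => 0 | M2_F => 0
  | M2_D k => (q ^ k * t + q ^ (- k) * t^-1)^-1 end.
apply: (@alg_quot_neq0 _ _ chi) => x y [] *;
  rewrite !free_charE /= ?(mulr0, mul0r, subr0) //.
- by rewrite mulfV.
- by rewrite mulVf.
- by rewrite mulVf.
- by rewrite mulfV.
- by rewrite mulrC.
- by rewrite mulrC.
Qed.

Section Algebra.
Variable q_neq0 : q != 0.

HB.instance Definition _ := GRing.PzRing.on (Uq_m2 q_neq0).
HB.instance Definition _ := GRing.Lmodule.on (Uq_m2 q_neq0).
HB.instance Definition _ :=
  GRing.PzSemiRing_isNonZero.Build (Uq_m2 q_neq0) (Uq_m2_neq0 q_neq0).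
HB.instance Definition _ := GRing.Lmodule_isLalgebra.Build C (Uq_m2 q_neq0)
  (@alg_quot_scalerAl _ _ m2_rel).
HB.instance Definition _ := GRing.Lalgebra_isAlgebra.Build C (Uq_m2 q_neq0)
  (@alg_quot_scalerAr _ _ m2_rel).

Definition m2 (x : m2_gen) : Uq_m2 q_neq0 := alg_pi m2_rel (free_gen C x).

End Algebra.

End M2.

(* Main.v *)
From HB Require Import structures.
Require Import Defs.
From mathcomp Require Import all_boot all_order all_algebra.
From mathcomp Require Import boolp reals complex monalg ring.

Set Implicit Arguments.
Unset Strict Implicit.
Unset Printing Implicit Defensive.

Import GRing.Theory Num.Theory.
Local Open Scope ring_scope.

(** The source is the quotient of the free algebra on I, T1, T2 by three
    relations, so a homomorphism out of it is determined by the images of the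
    generators ([iso2_ext]) and exists as soon as these images satisfy the
    relations ([iso2_lift]). Only the three relations remain to be checked in
    the target.

    Each left-hand side is a q-commutator [x, y] = qh x y - qh^-1 y x, where qh
    is the square root of q. It is bilinear, and when x y = a y x it equals
    (qh a - qh^-1) y x: it vanishes for a = q^-1 and is qh (q - q^-1) y x for
    a = q. Write X = E D and Y = F D, with D the inverse of K + K^-1. As D
    commutes with K, both keep the weights of E and F: K X = q X K and
    K Y = q^-1 Y K. In these terms I is a multiple of K - K^-1, T2 = X - Y and
    T1 = i qh (X K + Y K^-1), so every term of the three q-commutators has
    a = q or a = q^-1, except two cross terms of [T2, T1].

    In [I, T2] and [T1, I] half of the terms vanish, and the rest are multiples
    of the claimed values because the factors q - q^-1 cancel
    ([qcomm_I_T2], [qcomm_T1_I]; the second uses i^2 = -1). In [T2, T1] the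
    diagonal terms vanish and the cross terms add up to a multiple of
    X Y (q^-1 K + q K^-1) - Y X (q K + q^-1 K^-1). Moving the left factor D
    past F, respectively E, turns it into the inverse of the parenthesis, which
    leaves E F D - F E D = 0 ([qcomm_T2_T1]). *)

(** * Maps out of free algebras and their quotients *)

Section FreeLift.
Variables (K : comNzRingType) (X : choiceType) (A : algType K) (v : X -> A).

Definition word_eval (m : {fmonom X}) : A := \prod_(x <- m) v x.

Lemma word_eval_mmorphism : mmorphism word_eval.
Proof.
split=> [m n|]; rewrite /word_eval; last by rewrite fm1 big_nil.
by rewrite fmM big_cat.
Qed.

HB.instance Definition _ := isMultiplicative.Build {fmonom X} A word_eval
  word_eval_mmorphism.

Definition free_lift (x : free_alg K X) : A := mmap (in_alg A) word_eval x.

Lemma free_lift_gen x : free_lift (free_gen K x) = v x.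
Proof.
by rewrite /free_lift free_gen.unlock mmapU /= scale1r mul1r /word_eval fmuE big_seq1.
Qed.

Lemma free_lift_is_additive : zmod_morphism free_lift.
Proof. exact: (raddfB (mmap (in_alg A) word_eval)). Qed.

HB.instance Definition _ := GRing.isZmodMorphism.Build (free_alg K X) A free_lift
  free_lift_is_additive.

Lemma free_lift_is_monoid_morphism : monoid_morphism free_lift.
Proof.
(* Scalars are central, which is what multiplicativity of mmap asks for. *)
have [oneE mulE] : monoid_morphism (mmap (in_alg A) word_eval).
  have [] := @commr_mmap_is_multiplicative _ _ _ (in_alg A) word_eval.
    by move=> g m m'; rewrite /GRing.comm /= mulr_algl mulr_algr.
  by [].
split=> [|x y]; first by rewrite /GRing.one /= free_one.unlock.
by rewrite [x * y]/GRing.mul /= free_mul.unlock; apply: mulE.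
Qed.

HB.instance Definition _ := GRing.isMonoidMorphism.Build (free_alg K X) A
  free_lift free_lift_is_monoid_morphism.

Lemma free_lift_is_scalable : scalable free_lift.
Proof.
move=> c x; rewrite /GRing.scale /= free_scale.unlock.
by rewrite -[RHS]mulr_algl; apply: mmapZ.
Qed.

HB.instance Definition _ := GRing.isScalable.Build K (free_alg K X) A *:%R
  free_lift free_lift_is_scalable.

End FreeLift.

(** A free algebra is spanned by words, and words are products of generators. *)
Lemma free_alg_ind (K : comNzRingType) (X : choiceType)
    (P : free_alg K X -> Prop) :
    P 1 -> (forall x, P (free_gen K x)) ->
    (forall x y, P x -> P y -> P (x + y)) ->
    (forall x y, P x -> P y -> P (x * y)) ->
    (forall c x, P x -> P (c *: x)) ->
  forall x, P x.
Proof.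
move=> P1 Pgen PD PM PZ x.
have P0 : P 0 by rewrite -(scale0r 1); apply: PZ.
have Pword (s : seq X) : P (<< FMonom s >> : {malg K[{fmonom X}]}).
  elim: s => [|a s IHs].
    by move: P1; rewrite /GRing.one /= free_one.unlock -[FMonom _]fmoneE.
  have := PM _ _ (Pgen a) IHs.
  rewrite [X in P X -> _]/GRing.mul /= free_mul.unlock free_gen.unlock.
  by rewrite malgM_def fgmulUU mulr1 /mul /= fmmulE fmuE.
rewrite [x](monalgE (x : {malg K[{fmonom X}]})).
apply: (big_ind P) => // -[s] _.
have := PZ (x : {malg _[_]})@_(FMonom s) _ (Pword s).
rewrite /GRing.scale /= free_scale.unlock.
congr P; apply/malgP => m.
by rewrite mcoeffZ !mcoeffU mulrnAr mulr1.
Qed.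

Section QuotLift.
Variables (K : comNzRingType) (A B : algType K) (rel : A -> A -> Prop).
Variable f : {lrmorphism A -> B}.
Hypothesis f_rel : forall x y, rel x y -> f x = f y.

Lemma rel_ideal_ker x : rel_ideal rel x -> f x = 0.
Proof.
elim=> [{}x y /f_rel fxy||{}x y _ fx _ fy|a {}x _ fx|{}x a _ fx].
- by rewrite rmorphB /= fxy subrr.
- by rewrite rmorph0.
- by rewrite rmorphD /= fx fy addr0.
- by rewrite rmorphM /= fx mulr0.
- by rewrite rmorphM /= fx mul0r.
Qed.

Definition quot_lift (u : alg_quot rel) : B := f (repr u).

Lemma quot_lift_pi x : quot_lift (alg_pi rel x) = f x.
Proof.
by apply/eqP; rewrite -subr_eq0 -rmorphB; apply/eqP/rel_ideal_ker/alg_repr_pi.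
Qed.

Lemma quot_liftB : zmod_morphism quot_lift.
Proof.
elim/alg_quot_ind=> x; elim/alg_quot_ind=> y.
suff -> : alg_pi rel x - alg_pi rel y = alg_pi rel (x - y).
  by rewrite !quot_lift_pi rmorphB.
by apply/eqP; rewrite subr_eq -alg_piD subrK.
Qed.

Lemma quot_liftM : monoid_morphism quot_lift.
Proof.
split; first by rewrite [LHS]quot_lift_pi rmorph1.
elim/alg_quot_ind=> x; elim/alg_quot_ind=> y.
by rewrite [_ * _]alg_pi_mul !quot_lift_pi rmorphM.
Qed.

Lemma quot_liftZ : scalable quot_lift.
Proof.
move=> c; elim/alg_quot_ind=> x.
by rewrite [_ *: _]alg_pi_scale !quot_lift_pi linearZ.
Qed.

End QuotLift.

(** * The universal property of the source *)

Section Iso2Universal.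
Variables (C : numClosedFieldType) (qh : C) (B : algType C).

(** Bundled morphisms are equal once the functions are, because the remaining
    fields are propositions. *)
Lemma iso2_ext (f g : {lrmorphism Uq_iso2 qh -> B}) :
  (forall x, f (iso2 qh x) = g (iso2 qh x)) -> f = g.
Proof.
move=> fg; have {}fg : f = g :> (Uq_iso2 qh -> B).
  apply/funext; elim/alg_quot_ind; apply: free_alg_ind.
  - by rewrite [f _]rmorph1 [g _]rmorph1.
  - exact: fg.
  - by move=> x y fx fy; rewrite alg_piD [f _]rmorphD [g _]rmorphD /= fx fy.
  - by move=> x y fx fy; rewrite -alg_pi_mul [f _]rmorphM [g _]rmorphM /= fx fy.
  - move=> c x fx; rewrite -alg_pi_scale.
    by rewrite [f _](linearZ_LR f) [g _](linearZ_LR g) /= fx.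
case: f g fg => [f fP] [g gP] /= fg; case: _ / fg in gP *.
by congr GRing.LRMorphism.Pack; case: fP gP => [[?] [?] [?]] [[?] [?] [?]];
  congr GRing.LRMorphism.Class; congr (_ _); apply: Prop_irrelevance.
Qed.

Variables i t1 t2 : B.

Definition iso2_val (x : iso2_gen) : B :=
  match x with Iso2_I => i | Iso2_T1 => t1 | Iso2_T2 => t2 end.

Hypothesis it2 : qh *: (i * t2) - qh^-1 *: (t2 * i) = t1.
Hypothesis t1i : qh *: (t1 * i) - qh^-1 *: (i * t1) = t2.
Hypothesis t2t1 : qh *: (t2 * t1) - qh^-1 *: (t1 * t2) = 0.

Lemma iso2_val_rel x y : iso2_rel qh x y ->
  free_lift iso2_val x = free_lift iso2_val y.
Proof.
by case; rewrite ?rmorph0 rmorphB /= !linearZ /= !rmorphM /= !free_lift_gen scalerN.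
Qed.

Lemma iso2_lift : exists f : {lrmorphism Uq_iso2 qh -> B},
  [/\ f (iso2 qh Iso2_I) = i, f (iso2 qh Iso2_T1) = t1
    & f (iso2 qh Iso2_T2) = t2].
Proof.
pose f : Uq_iso2 qh -> B :=
  @quot_lift C (free_alg C iso2_gen) B (@iso2_rel C qh) (free_lift iso2_val).
pose f_add := GRing.isZmodMorphism.Build (Uq_iso2 qh) B f (quot_liftB iso2_val_rel).
pose f_mul := GRing.isMonoidMorphism.Build (Uq_iso2 qh) B f (quot_liftM iso2_val_rel).
pose f_scale := GRing.isScalable.Build C (Uq_iso2 qh) B *:%R f
  (quot_liftZ iso2_val_rel).
pose fL : {lrmorphism Uq_iso2 qh -> B} := HB.pack f f_add f_mul f_scale.
by exists fL; split; rewrite [LHS](quot_lift_pi iso2_val_rel) /= free_lift_gen.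
Qed.

End Iso2Universal.

(** * q-commutators *)

Section QCommutator.
Variables (C : numClosedFieldType) (A : algType C) (qh : C).
Hypothesis qh_neq0 : qh != 0.

Definition qcomm (x y : A) : A := qh *: (x * y) - qh^-1 *: (y * x).

Lemma qcomm_scaled a x y :
  x * y = a *: (y * x) -> qcomm x y = (qh * a - qh^-1) *: (y * x).
Proof. by move=> xy; rewrite /qcomm xy scalerA scalerBl. Qed.

Lemma qcomm_scaled_qV x y : x * y = qh ^- 2 *: (y * x) -> qcomm x y = 0.
Proof.
move=> /qcomm_scaled ->; have -> : qh * qh ^- 2 - qh^-1 = 0 by field.
exact: scale0r.
Qed.

Lemma qcomm_scaled_q x y : x * y = qh ^+ 2 *: (y * x) ->
  qcomm x y = (qh * (qh ^+ 2 - qh ^- 2)) *: (y * x).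
Proof.
by move=> /qcomm_scaled ->; congr (_ *: _); field.
Qed.

Lemma qcommDl x1 x2 y : qcomm (x1 + x2) y = qcomm x1 y + qcomm x2 y.
Proof. by rewrite /qcomm mulrDl mulrDr !scalerDr opprD addrACA. Qed.

Lemma qcommDr x y1 y2 : qcomm x (y1 + y2) = qcomm x y1 + qcomm x y2.
Proof. by rewrite /qcomm mulrDl mulrDr !scalerDr opprD addrACA. Qed.

Lemma qcommZl a x y : qcomm (a *: x) y = a *: qcomm x y.
Proof.
by rewrite /qcomm -scalerAl -scalerAr !scalerA scalerBr !scalerA
  ![_ * a]mulrC.
Qed.

Lemma qcommZr a x y : qcomm x (a *: y) = a *: qcomm x y.
Proof.
by rewrite /qcomm -scalerAl -scalerAr !scalerA scalerBr !scalerA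
  ![_ * a]mulrC.
Qed.

Lemma qcommNl x y : qcomm (- x) y = - qcomm x y.
Proof. by rewrite -!scaleN1r qcommZl. Qed.

Lemma qcommNr x y : qcomm x (- y) = - qcomm x y.
Proof. by rewrite -!scaleN1r qcommZr. Qed.

Definition qcommE := (qcommDl, qcommDr, qcommNl, qcommNr, qcommZl, qcommZr).

End QCommutator.

Lemma scaled_comm_inv (C : fieldType) (A : algType C) (g h x : A) (a : C) :
  g * h = 1 -> h * g = 1 -> a != 0 ->
  g * x = a *: (x * g) -> h * x = a^-1 *: (x * h).
Proof.
move=> gh hg a0 gx; apply: (canRL (scalerK a0)).
by rewrite -[a *: _]mulr1 -gh mulrA -scalerAl -[h * x * g]mulrA
  scalerAr -gx mulrA hg mul1r.
Qed.

(** * The relations of the source hold for the images *)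

(** Dup and Ddown stand for the inverses of q^k K + q^-k K^-1 with k = 1 and
    k = -1, which appear when D, the one with k = 0, moves past E or F. *)
Section Images.
Variables (C : numClosedFieldType) (A : algType C) (qh : C).
Hypothesis qh_neq0 : qh != 0.

Variables (i : C) (K Kinv E F D Dup Ddown : A).
Let q := qh ^+ 2.
Hypothesis sqr_i : i ^+ 2 = -1.
Hypothesis q2_neq1 : q ^+ 2 != 1.
Hypothesis KKinv : K * Kinv = 1.
Hypothesis KinvK : Kinv * K = 1.
Hypothesis KE : K * E = q *: (E * K).
Hypothesis KF : K * F = q^-1 *: (F * K).
Hypothesis EF : E * F = F * E.
Hypothesis KD : K * D = D * K.
Hypothesis KinvD : Kinv * D = D * Kinv.
Hypothesis DE : D * E = E * Dup.
Hypothesis DF : D * F = F * Ddown.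
Hypothesis Dup_inv : Dup * (q *: K + q^-1 *: Kinv) = 1.
Hypothesis Ddown_inv : Ddown * (q^-1 *: K + q *: Kinv) = 1.

Let q_neq0 : q != 0. Proof. by rewrite expf_neq0. Qed.

Let X := E * D.
Let Y := F * D.

Let KX : K * X = q *: (X * K).
Proof. by rewrite /X mulrA KE -scalerAl -!mulrA KD. Qed.

Let KY : K * Y = q^-1 *: (Y * K).
Proof. by rewrite /Y mulrA KF -scalerAl -!mulrA KD. Qed.

Let KinvX : Kinv * X = q^-1 *: (X * Kinv).
Proof. exact: (scaled_comm_inv KKinv KinvK). Qed.

Let KinvY : Kinv * Y = q *: (Y * Kinv).
Proof.
rewrite -[q in RHS]invrK.
by apply: (scaled_comm_inv KKinv KinvK) => //; rewrite invr_neq0.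
Qed.

Let I := (i / (q - q^-1)) *: (K - Kinv).
Let T2 := X - Y.
Let T1 := (i * qh) *: (X * K + Y * Kinv).

Let qq_neq1 : q * q - 1 != 0.
Proof. by rewrite -expr2 subr_eq0. Qed.

(** Ordering E and F before K and Kinv makes the two terms carry the same
    scalar, as qh^-1 q = qh. *)
Lemma T1_normal_form :
  (i *: ((qh^-1 *: K) * E) + i *: ((qh^-1 *: Kinv) * F)) * D = T1.
Proof.
rewrite -!scalerAl -!scalerDr -!scalerAl mulrDl -!mulrA -/X -/Y.
rewrite KX KinvY.
by rewrite -!scalerDr !scalerA /q; congr (_ *: _); field.
Qed.

Lemma qcomm_I_T2 : qcomm qh I T2 = T1.
Proof.
rewrite !qcommE (qcomm_scaled_q qh_neq0 KX) (qcomm_scaled_q qh_neq0 KinvY).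
rewrite (qcomm_scaled_qV qh_neq0 KY) (qcomm_scaled_qV qh_neq0 KinvX)
  !oppr0 !(add0r, addr0) scalerN opprK.
rewrite -!scalerDr scalerA; congr (_ *: _).
by rewrite -/q; field; rewrite q_neq0 qq_neq1.
Qed.

Let KXK : X * K * K = q^-1 *: (K * (X * K)).
Proof. by rewrite mulrA KX -scalerAl scalerA mulVf // scale1r. Qed.

Let XKKinv : X * K * Kinv = q *: (Kinv * (X * K)).
Proof.
by rewrite mulrA KinvX -scalerAl scalerA mulfV // scale1r -!mulrA KinvK KKinv.
Qed.

Let YKinvK : Y * Kinv * K = q *: (K * (Y * Kinv)).
Proof.
by rewrite mulrA KY -scalerAl scalerA mulfV // scale1r -!mulrA KinvK KKinv.
Qed.

Let YKinvKinv : Y * Kinv * Kinv = q^-1 *: (Kinv * (Y * Kinv)).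
Proof. by rewrite mulrA KinvY -scalerAl scalerA mulVf // scale1r. Qed.

Lemma qcomm_T1_I : qcomm qh T1 I = T2.
Proof.
rewrite !qcommE (qcomm_scaled_q qh_neq0 XKKinv) (qcomm_scaled_q qh_neq0 YKinvK).
rewrite (qcomm_scaled_qV qh_neq0 KXK) (qcomm_scaled_qV qh_neq0 YKinvKinv)
  !(oppr0, scaler0) !(add0r, addr0).
have -> : Kinv * (X * K) = q^-1 *: X.
  by rewrite mulrA KinvX -scalerAl -mulrA KinvK mulr1.
have -> : K * (Y * Kinv) = q^-1 *: Y.
  by rewrite mulrA KY -scalerAl -mulrA KKinv mulr1.
(* The left-hand side is i^2 (Y - X). *)
have -> : T2 = -1 *: (- X + Y) by rewrite scaleN1r opprD opprK.
rewrite -!scalerN -!scalerDr !scalerA -sqr_i; congr (_ *: _).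
by rewrite /q; field; rewrite -/q qh_neq0 qq_neq1.
Qed.

(** The right-hand D commutes with K and Kinv and goes to the end; D F = F Ddown
    then makes Ddown meet the element that it inverts. *)
Let XY_down : X * Y * (q^-1 *: K + q *: Kinv) = E * F * D.
Proof.
have DP : D * (q^-1 *: K + q *: Kinv) = (q^-1 *: K + q *: Kinv) * D.
  by rewrite mulrDl mulrDr -!scalerAl -!scalerAr KD KinvD.
rewrite /X /Y -!mulrA DP; congr (E * _).
by rewrite [D * _]mulrA DF -mulrA [Ddown * _]mulrA Ddown_inv mul1r.
Qed.

Let YX_up : Y * X * (q *: K + q^-1 *: Kinv) = F * E * D.
Proof.
have DP : D * (q *: K + q^-1 *: Kinv) = (q *: K + q^-1 *: Kinv) * D.
  by rewrite mulrDl mulrDr -!scalerAl -!scalerAr KD KinvD.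
rewrite /X /Y -!mulrA DP; congr (F * _).
by rewrite [D * _]mulrA DE -mulrA [Dup * _]mulrA Dup_inv mul1r.
Qed.

Let X_XK : X * (X * K) = q^-1 *: (X * K * X).
Proof. by rewrite -mulrA KX -scalerAr scalerA mulVf // scale1r. Qed.

Let Y_YKinv : Y * (Y * Kinv) = q^-1 *: (Y * Kinv * Y).
Proof. by rewrite -mulrA KinvY -scalerAr scalerA mulVf // scale1r. Qed.

Lemma qcomm_T2_T1 : qcomm qh T2 T1 = 0.
Proof.
rewrite !qcommE (qcomm_scaled_qV qh_neq0 X_XK) (qcomm_scaled_qV qh_neq0 Y_YKinv)
  add0r addr0 -scalerBr.
suff -> : qcomm qh X (Y * Kinv) - qcomm qh Y (X * K) = 0 by rewrite scaler0.
have <- : qh^-1 *: (X * Y * (q^-1 *: K + q *: Kinv)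
                    - Y * X * (q *: K + q^-1 *: Kinv)) =
          qcomm qh X (Y * Kinv) - qcomm qh Y (X * K).
  rewrite /qcomm -[Y * Kinv * X]mulrA -[X * K * Y]mulrA KinvX KY.
  rewrite !mulrDr -!scalerAr !mulrA.
  have qhqV : qh^-1 * q = qh by rewrite /q; field.
  rewrite !(scalerBr, scalerDr) !scalerA qhqV opprB opprD [RHS]addrACA.
  by rewrite [X in X + _ = _]addrC [X in _ + X = _]addrC.
by rewrite XY_down YX_up EF subrr scaler0.
Qed.

End Images.

(** * The relations of the target *)

Section M2Relations.
Variables (C : numClosedFieldType) (q : C) (q_neq0 : q != 0).

Definition m2_pi (x : free_alg C m2_gen) : Uq_m2 q_neq0 := alg_pi (m2_rel q) x.

Let m2_pi1 : m2_pi 1 = 1. Proof. by []. Qed.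

Let m2_pi0 : m2_pi 0 = 0. Proof. exact: alg_pi0. Qed.

Let m2_piD x y : m2_pi (x + y) = m2_pi x + m2_pi y.
Proof. exact: alg_piD. Qed.

Let m2_piB x y : m2_pi (x - y) = m2_pi x - m2_pi y.
Proof. by apply/eqP; rewrite eq_sym subr_eq -m2_piD subrK. Qed.

Let m2_piM x y : m2_pi (x * y) = m2_pi x * m2_pi y.
Proof. by rewrite [RHS]alg_pi_mul. Qed.

Let m2_piZ c x : m2_pi (c *: x) = c *: m2_pi x.
Proof. by rewrite [RHS]alg_pi_scale. Qed.

Lemma m2_pi_rel x y : m2_rel q x y -> m2_pi x = m2_pi y.
Proof. by move=> xy; apply/eqP/alg_piP/rel_ideal_rel. Qed.

Lemma m2_pi_gen x : m2_pi (free_gen C x) = m2 q_neq0 x.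
Proof. by []. Qed.

Local Notation K := (m2 q_neq0 M2_K).
Local Notation Kinv := (m2 q_neq0 M2_Kinv).
Local Notation E := (m2 q_neq0 M2_E).
Local Notation F := (m2 q_neq0 M2_F).
Local Notation D k := (m2 q_neq0 (M2_D k)).

Let m2_piE := (m2_pi1, m2_pi0, m2_piM, m2_piB, m2_piD, m2_piZ, m2_pi_gen).

Lemma m2_KKinvE : K * Kinv = 1.
Proof. by have := m2_pi_rel (m2_KKinv q); rewrite !m2_piE. Qed.

Lemma m2_KinvKE : Kinv * K = 1.
Proof. by have := m2_pi_rel (m2_KinvK q); rewrite !m2_piE. Qed.

Lemma m2_KEE : K * E = q *: (E * K).
Proof.
have := m2_pi_rel (m2_KE q); rewrite !m2_piE => /(congr1 ( *%R^~ K)).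
by rewrite -mulrA m2_KinvKE mulr1 -scalerAl.
Qed.

Lemma m2_KFE : K * F = q^-1 *: (F * K).
Proof.
have := m2_pi_rel (m2_KF q); rewrite !m2_piE => /(congr1 ( *%R^~ K)).
by rewrite -mulrA m2_KinvKE mulr1 -scalerAl.
Qed.

Lemma m2_EFE : E * F = F * E.
Proof. by have := m2_pi_rel (m2_EF q); rewrite !m2_piE => /subr0_eq. Qed.

Lemma m2_DPE k : D k * (q ^ k *: K + q ^ (- k) *: Kinv) = 1.
Proof. by have := m2_pi_rel (m2_DP q k); rewrite !m2_piE. Qed.

Lemma m2_KDE k : K * D k = D k * K.
Proof. by have := m2_pi_rel (m2_KD q k); rewrite !m2_piE. Qed.

Lemma m2_KinvDE k : Kinv * D k = D k * Kinv.
Proof. by have := m2_pi_rel (m2_KinvD q k); rewrite !m2_piE. Qed.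

Lemma m2_DEE k : D k * E = E * D (k + 1).
Proof. by have := m2_pi_rel (m2_DE q k); rewrite !m2_piE. Qed.

Lemma m2_DFE k : D k * F = F * D (k - 1).
Proof. by have := m2_pi_rel (m2_DF q k); rewrite !m2_piE. Qed.

End M2Relations.

Theorem proposition2 (R : realType) (q qh : R[i]) (q_neq0 : q != 0)
    (q2_neq1 : q ^+ 2 != 1) (qhE : qh ^+ 2 = q) :
  exists! psi : {lrmorphism Uq_iso2 qh -> Uq_m2 q_neq0},
    let I := iso2 qh Iso2_I in
    let T1 := iso2 qh Iso2_T1 in
    let T2 := iso2 qh Iso2_T2 in
    let K := m2 q_neq0 M2_K in
    let Kinv := m2 q_neq0 M2_Kinv in
    let E := m2 q_neq0 M2_E in
    let F := m2 q_neq0 M2_F in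
    let D := m2 q_neq0 (M2_D 0) in
    [/\ psi I = ('i%C / (q - q^-1)) *: (K - Kinv),
        psi T2 = (E - F) * D
      & psi T1 = ('i%C *: ((qh^-1 *: K) * E) + 'i%C *: ((qh^-1 *: Kinv) * F)) * D].
Proof.
(* The type of the target depends on q, so q is replaced by qh ^ 2 at once. *)
subst q; set q := qh ^+ 2 in q_neq0 q2_neq1 *.
have qh_neq0 : qh != 0 by apply: contraNneq q_neq0 => qh0; rewrite /q qh0 expr0n.
set K := m2 q_neq0 M2_K; set Kinv := m2 q_neq0 M2_Kinv.
set E := m2 q_neq0 M2_E; set F := m2 q_neq0 M2_F.
set D := m2 q_neq0 (M2_D 0).
have sqr_i : 'i%C ^+ 2 = -1 :> R[i] by exact: sqr_i.
have KE : K * E = q *: (E * K) := m2_KEE q_neq0.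
have KF : K * F = q^-1 *: (F * K) := m2_KFE q_neq0.
have KKinv : K * Kinv = 1 := m2_KKinvE q_neq0.
have KinvK : Kinv * K = 1 := m2_KinvKE q_neq0.
have EF : E * F = F * E := m2_EFE q_neq0.
have KD : K * D = D * K := m2_KDE q_neq0 0.
have KinvD : Kinv * D = D * Kinv := m2_KinvDE q_neq0 0.
have DE : D * E = E * m2 q_neq0 (M2_D 1).
  by have := m2_DEE q_neq0 0; rewrite add0r.
have DF : D * F = F * m2 q_neq0 (M2_D (-1)).
  by have := m2_DFE q_neq0 0; rewrite add0r.
have Dup : m2 q_neq0 (M2_D 1) * (q *: K + q^-1 *: Kinv) = 1.
  exact: (m2_DPE q_neq0 1).
have Ddown : m2 q_neq0 (M2_D (-1)) * (q^-1 *: K + q *: Kinv) = 1.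
  exact: (m2_DPE q_neq0 (-1)).
pose i := ('i%C / (q - q^-1)) *: (K - Kinv).
pose t2 := E * D - F * D.
pose t1 := ('i%C * qh) *: (E * D * K + F * D * Kinv).
have t2E : (E - F) * D = t2 by rewrite mulrBl.
have t1E : ('i%C *: ((qh^-1 *: K) * E) + 'i%C *: ((qh^-1 *: Kinv) * F)) * D = t1.
  exact: (T1_normal_form qh_neq0 'i%C KKinv KinvK KE KF KD).
have it2 := qcomm_I_T2 qh_neq0 'i%C q2_neq1 KKinv KinvK KE KF KD.
have t1i := qcomm_T1_I qh_neq0 sqr_i q2_neq1 KKinv KinvK KE KF KD.
have t2t1 := qcomm_T2_T1 qh_neq0 'i%C KKinv KinvK KE KF EF KD KinvD DE DF Dup Ddown.
have [psi [psiI psiT1 psiT2]] := iso2_lift it2 t1i t2t1.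
exists psi; split=> [|phi [phiI phiT2 phiT1]]; first by split; rewrite ?t2E ?t1E.
apply: iso2_ext => -[].
- exact: etrans psiI (esym phiI).
- exact: etrans psiT1 (esym (etrans phiT1 t1E)).
- exact: etrans psiT2 (esym (etrans phiT2 t2E)).
Qed.
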